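(* Let $m \in \mathbb{N}=\{0,1,2,\dots\}$ and let $k$ be a positive integer. Then $$D_{2k,1-k-m}(N) = 0 \quad \text{for } N = 1, 2, \ldots, m+k-1,$$ and for all $n \in \mathbb{N}$ $$D_{2k,1-k-m}(n+m+k) = (-1)^{\binom{m+k}{2}} D_{2k,1-k+m}(n).$$
   Context: Let $C_n = \frac{1}{n+1}\binom{2n}{n}$ be the Catalan numbers and $c(x) = \sum_{n\ge 0} C_n x^n$ their generating function (a formal power series). For a positive integer $k$ and $n \ge 0$ let $C_{k,n} = [x^n]\, c(x)^k$ be the coefficient of $x^n$ in $c(x)^k$, and set $C_{k,n}=0$ for $n<0$. For $M \in \mathbb{Z}$ and integers $K, N \ge 1$ define the Hankel determinant $$D_{K,M}(N) = \det\left(C_{K,i+j+M}\right)_{i,j=0}^{N-1},$$ and set $D_{K,M}(0)=1$. *)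

(* Defs.v *)
From mathcomp Require Import all_boot all_order all_algebra.
Set Implicit Arguments.
Unset Strict Implicit.
Unset Printing Implicit Defensive.
Import Order.TTheory GRing.Theory Num.Theory.
Local Open Scope ring_scope.

(* A formal power series is represented by its sequence of coefficients, here
   over rat, so that the division in the Catalan numbers is the genuine one. *)
Definition fps : Type := nat -> rat.

Definition fps_one : fps := fun n => (n == 0)%N%:R.

Definition fps_mul (f g : fps) : fps :=
  fun n => \sum_(i < n.+1) f i * g (n - i)%N.

Definition fps_exp (f : fps) (k : nat) : fps := iter k (fps_mul f) fps_one.

Definition catalan_series : fps := fun n => 'C(2 * n, n)%:R / n.+1%:R.

Definition catalan_conv (k : nat) (z : int) : rat :=
  match z with
  | Posz n => fps_exp catalan_series k n
  | Negz _ => 0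
  end.

(* For N = 0 the determinant of the empty matrix is 1 (det_mx00). *)
Definition hankel_det (K : nat) (M : int) (N : nat) : rat :=
  \det (\matrix_(i < N, j < N) catalan_conv K (i%:Z + j%:Z + M)).

(* Main.v *)
Require Import Defs.
From mathcomp Require Import all_boot all_order all_algebra.
From mathcomp Require Import zify ring.
Set Implicit Arguments.
Unset Strict Implicit.
Unset Printing Implicit Defensive.
Import Order.TTheory GRing.Theory Num.Theory.
Local Open Scope ring_scope.

(** Write a for the coefficient sequence of c^(2k), b for that of its
    reciprocal c^(-2k), and s = m + k.

    Multiplying the Hankel matrix (a_(i+j+1-s)) of size s + n on the right by
    the unitriangular Toeplitz matrix of b convolves each row with b.  For the
    first s rows this is the whole convolution a * b = 1, so these rows become
    an antidiagonal block followed by zeros.  In the last n rows, the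
    convolution lacks its first terms, and the lower right block is minus
    those missing terms, namely the unitriangular Toeplitz matrix of a times
    the Hankel matrix (- b_(i+j+s+1)).  Hence ([hankel_reciprocal])
      det (a_(i+j+1-s))_(s+n) = (-1)^(s choose 2) det (- b_(i+j+s+1))_n.

    It remains to compare b with a.  The equation c = 1 + x c^2
    ([catalan_convolution]) says that u = 1/c and v = x c satisfy u + v = 1 and
    u v = x.  So u^r + v^r is a Lucas polynomial in x, of degree at most r/2
    ([catalan_power_sum_coef]); for r = 2k this means b_j = - a_(j-2k) as soon
    as j > k, and j = i + j' + s + 1 is always in that range.  This turns
    - b_(i+j+s+1) into a_(i+j+1-k+m).

    The first claim holds because the top row of the matrix only involves
    negative indices.

    Power series are handled through their truncations modulo x^M, which live
    in the ring of polynomials; only finitely many coefficients of a and b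
    matter for each determinant. *)

(** * Hankel determinants of reciprocal series *)

Lemma det_antidiag (R : comNzRingType) (s : nat) :
  \det (\matrix_(i < s, j < s) ((i + j).+1 == s)%:R) = (-1) ^+ 'C(s, 2) :> R.
Proof.
elim: s => [|s IHs]; first by rewrite det_mx00.
rewrite (expand_det_row _ ord0) (bigD1 ord_max) //= big1 ?addr0; last first.
  move=> j jneq; rewrite mxE add0n eqSS; case: eqP => [js|_]; last by rewrite mul0r.
  by case/eqP: jneq; apply: val_inj.
rewrite mxE add0n eqxx mul1r /cofactor add0n binS bin1 exprD mulrC -IHs.
congr (\det _ * _); apply/matrixP => i j; rewrite !mxE /= /bump /=.
by rewrite leqNgt ltn_ord add0n add1n addSn eqSS.
Qed.

Lemma det_toeplitz_upper (R : comNzRingType) (n : nat) (b : {poly R}) :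
  b`_0 = 1 ->
  \det (\matrix_(i < n, j < n) (if (i <= j)%N then b`_(j - i) else 0)) = 1.
Proof.
move=> b0; rewrite -det_tr det_trig.
  by rewrite big1 // => i _; rewrite !mxE leqnn subnn.
apply/is_trig_mxP => i j ltij; rewrite !mxE leqNgt ltij //.
Qed.

(** The left side is an entry of the Hankel matrix times the Toeplitz matrix of
    b.  The full convolution of 'X^s * a with b is 'X^s, and row i starts at
    index i + 1, so that the terms of index at most i are missing. *)
Lemma partial_convolution (R : comNzRingType) (a b : {poly R}) (s i l : nat) :
  (forall j, (j.+1 + s <= (i + l).+2)%N -> (a * b)`_j = (j == 0)%N%:R) ->
  \sum_(j < l.+1) ('X^s * a)`_(i + j).+1 * b`_(l - j) =
  ((i + l).+1 == s)%:R
    - \sum_(q < i.+1) ('X^s * a)`_q * b`_((i + l).+1 - q).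
Proof.
move=> ab1.
have <- : ('X^s * a * b)`_(i + l).+1 = ((i + l).+1 == s)%:R.
  rewrite -mulrA coefXnM; case: ltnP => [lt_s|le_s].
    by rewrite ltn_eqF.
  rewrite ab1; last by lia.
  by rewrite subn_eq0 eqn_leq le_s andbT.
rewrite coefM.
have -> : (i + l).+2 = (i.+1 + l.+1)%N by lia.
rewrite big_split_ord /= [RHS]addrC addKr.
by apply: eq_bigr => j _; rewrite addSn subSS subnDl.
Qed.

(** A case of the complementary minor identity: for a unitriangular Toeplitz
    matrix and its inverse, the minors compared here are Hankel determinants
    up to a reversal of rows. *)
Lemma hankel_reciprocal (R : comNzRingType) (a b : {poly R}) (s n : nat) :
  a`_0 = 1 -> b`_0 = 1 ->
  (forall j, (j < s + n + n)%N -> (a * b)`_j = (j == 0)%N%:R) ->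
  \det (\matrix_(i < s + n, j < s + n) ('X^s * a)`_(i + j).+1) =
  (-1) ^+ 'C(s, 2) * \det (\matrix_(i < n, j < n) - b`_(i + j + s).+1).
Proof.
move=> a0 b0 ab1.
set H := (X in \det X = _); set F := (X in _ * \det X).
pose V := \matrix_(i < s + n, j < s + n) (if (i <= j)%N then b`_(j - i) else 0).
pose L := \matrix_(i < n, j < n) (if (j <= i)%N then a`_(i - j) else 0).
have HVE i l : (H *m V) i l = ((i + l).+1 == s)%:R
    - \sum_(q < i.+1) ('X^s * a)`_q * b`_((i + l).+1 - q).
  rewrite -partial_convolution => [|j le_j]; last first.
    by apply: ab1; have := ltn_ord i; have := ltn_ord l; lia.
  rewrite mxE (big_ord_widen (s + n)%N
    (fun j => ('X^s * a)`_(i + j).+1 * b`_(l - j))) ?ltn_ord //.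
  rewrite [RHS]big_mkcond; apply: eq_bigr => j _.
  by rewrite !mxE ltnS; case: ifP => // _; rewrite mulr0.
have HVtop (i l : 'I_(s + n)) : (i < s)%N -> (H *m V) i l = ((i + l).+1 == s)%:R.
  move=> lt_is; rewrite HVE big1 ?subr0 // => q _.
  have lt_qs : (q < s)%N by have := ltn_ord q; lia.
  by rewrite coefXnM lt_qs mul0r.
have detV : \det V = 1 by apply: det_toeplitz_upper.
have detL : \det L = 1.
  rewrite -(det_toeplitz_upper n a0) -det_tr; congr (\det _).
  by apply/matrixP => i j; rewrite !mxE.
have -> : \det H = \det (H *m V) by rewrite det_mulmx detV mulr1.
rewrite -[H *m V]submxK.
have -> : ursubmx (H *m V) = 0.
  apply/matrixP => i l; rewrite 2![LHS]mxE HVtop ?ltn_ord //= mxE.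
  by case: eqP => //; lia.
have -> : ulsubmx (H *m V) = \matrix_(i, j) ((i + j).+1 == s)%:R.
  by apply/matrixP => i l; rewrite 2![LHS]mxE HVtop ?ltn_ord //= mxE.
have -> : drsubmx (H *m V) = L *m F.
  apply/matrixP => i l; rewrite 2![LHS]mxE HVE /=.
  have /negPf-> : (s + i + (s + l)).+1 != s by lia.
  have -> : (s + i).+1 = (s + i.+1)%N by lia.
  rewrite sub0r big_split_ord /= big1 ?add0r; last first.
    by move=> q _; rewrite coefXnM ltn_ord mul0r.
  (* The missing term of index s + t is the summand of (L *m F) i l of index
     i - t, whence the reversal. *)
  rewrite mxE (reindex_inj rev_ord_inj) /= -sumrN.
  rewrite (big_ord_widen n (fun q : nat =>
    - (('X^s * a)`_(s + (i.+1 - q.+1)) *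
       b`_((s + i + (s + l)).+1 - (s + (i.+1 - q.+1)))))) ?ltn_ord //.
  rewrite big_mkcond; apply: eq_bigr => q _.
  rewrite !mxE ltnS; case: ifP => [le_qi|_]; last by rewrite mul0r.
  rewrite mulrN coefXnM ltnNge leq_addr /= addKn subSS.
  by congr (- (_ * b`_(_))); lia.
by rewrite det_lblock det_antidiag det_mulmx detL mul1r.
Qed.

(** * The Catalan series *)

Lemma catalan_seriesS (n : nat) :
  n.+2%:R * catalan_series n.+1 = (4 * n + 2)%:R * catalan_series n.
Proof.
rewrite /catalan_series.
have nz p : p.+1%:R != 0 :> rat by rewrite pnatr_eq0.
have E : (n.+1 * 'C(2 * n.+1, n.+1) = (4 * n + 2) * 'C(2 * n, n))%N.
  have -> : (2 * n.+1 = (2 * n).+2)%N by lia.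
  have e1 := mul_bin_diag (2 * n).+2 n; rewrite /= in e1.
  have e2 := mul_bin_down (2 * n).+1 n; rewrite /= in e2.
  have e3 : ((2 * n).+1 - n = n.+1)%N by lia.
  by rewrite e3 in e2; nia.
rewrite mulrC divfK ?nz // mulrA; apply: (mulIf (nz n)).
by rewrite divfK ?nz // -!natrM mulnC E.
Qed.

(** The identity c = 1 + x c^2.  Reversal of the sum shows that its terms
    weighted by i + 1 sum to (n + 2) / 2 times the sum itself; the recurrence
    of the Catalan numbers turns the weighted sum at n + 1 into the one at n. *)
Lemma catalan_convolution (n : nat) :
  \sum_(i < n.+1) catalan_series i * catalan_series (n - i)%N =
  catalan_series n.+1.
Proof.
pose S n := \sum_(i < n.+1) catalan_series i * catalan_series (n - i)%N.
pose T n := \sum_(i < n.+1)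
              i%:R * (catalan_series i * catalan_series (n - i)%N).
have T2 p : T p *+ 2 = p%:R * S p.
  rewrite mulr2n {1}/T (reindex_inj rev_ord_inj) /= /T -big_split /= mulr_sumr.
  apply: eq_bigr => i _; have le_ip : (i <= p)%N by rewrite -ltnS.
  rewrite subSS subKn // [catalan_series (p - i)%N * _]mulrC -mulrDl -natrD.
  by rewrite subnK.
have c0 : catalan_series 0 = 1 by rewrite /catalan_series bin0 divr1.
have ST p : T p.+1 + S p.+1 = catalan_series p.+1 + T p *+ 4 + S p *+ 2.
  rewrite /T /S -big_split /= big_ord_recl /= mul0r add0r c0 mul1r subn0 -addrA.
  congr (_ + _); rewrite -!sumrMnl -big_split; apply: eq_bigr => i _ /=.
  rewrite /bump /= add1n subSS.
  have -> : forall x y : rat,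
      i.+1%:R * (x * y) + x * y = i.+2%:R * x * y.
    by move=> x y; rewrite -[i.+2]addn1 natrD; ring.
  by rewrite catalan_seriesS natrD natrM; ring.
rewrite -/(S n); elim: n => [|n IHn].
  rewrite /S big_ord1 c0; apply/esym.
  have := catalan_seriesS 0; rewrite c0 mulr1 muln0 add0n => e.
  by apply: (@mulfI _ 2%:R); rewrite ?pnatr_eq0 ?mulr1.
apply: (@mulfI _ n.+3%:R); first by rewrite pnatr_eq0.
rewrite catalan_seriesS.
have e1 : n.+3%:R * S n.+1 = (T n.+1 + S n.+1) *+ 2.
  by rewrite mulrnDl T2 -[n.+3]addn2 natrD; ring.
rewrite e1 ST -IHn.
have -> : (S n + T n *+ 4 + S n *+ 2) *+ 2 = S n *+ 6 + (T n *+ 2) *+ 4 by ring.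
rewrite T2 natrD natrM -[n.+1]addn1 natrD; ring.
Qed.

(** * Truncated powers of the Catalan series *)

Definition fps_trunc (M : nat) (f : fps) : {poly rat} := \poly_(i < M) f i.

Lemma coef_fps_trunc_exp (M : nat) (f : fps) (r n : nat) :
  (n < M)%N -> (fps_trunc M f ^+ r)`_n = fps_exp f r n.
Proof.
elim: r n => [|r IHr] n lt_nM; first by rewrite expr0 coef1.
rewrite exprS coefM /fps_exp iterS; apply: eq_bigr => i _.
rewrite coef_poly IHr; last by lia.
by have -> : (i < M)%N by have := ltn_ord i; lia.
Qed.

Lemma catalan_trunc_reciprocal (M : nat) :
  let P := fps_trunc M catalan_series in
  exists q, P * (1 - 'X * P) = 1 + 'X^M * q.
Proof.
move=> P; pose D := P * (1 - 'X * P) - 1; exists (drop_poly M D).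
have low j : (j < M)%N -> D`_j = 0.
  have -> : D = P - 'X * (P * P) - 1 by rewrite /D; ring.
  move=> lt_jM; rewrite !coefB coefXM coef1 coef_poly lt_jM.
  case: j lt_jM => [|j] lt_jM /=.
    by rewrite /catalan_series bin0 divr1 subr0 subrr.
  rewrite coefM -catalan_convolution subr0; apply/eqP; rewrite subr_eq0.
  apply/eqP; apply: eq_bigr => i _; have lt_ij := ltn_ord i.
  by rewrite !coef_poly !ifT //; lia.
have -> : P * (1 - 'X * P) = 1 + D by rewrite [RHS]addrC subrK.
rewrite -{1}(poly_take_drop M D) ['X^M * _]mulrC.
suff -> : take_poly M D = 0 by rewrite add0r.
by apply/polyP => j; rewrite coef_take_poly coef0; case: ifP => // /low.
Qed.

(** With u = 1/c and v = x c one has u + v = 1 and u v = x, hence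
    u^(r+2) + v^(r+2) = (u^(r+1) + v^(r+1)) - x (u^r + v^r): by induction the
    power sum of exponent r is a polynomial of degree at most r / 2. *)
Lemma catalan_power_sum_coef (M r j : nat) :
  let P := fps_trunc M catalan_series in
  (j < M)%N -> (r < j.*2)%N ->
  ((1 - 'X * P) ^+ r + ('X * P) ^+ r)`_j = 0.
Proof.
move=> P; have [q Pq] := catalan_trunc_reciprocal M; rewrite -/P in Pq.
pose p r := (1 - 'X * P) ^+ r + ('X * P) ^+ r; rewrite -/(p r).
have pSS i : p i.+2 = p i.+1 - 'X * p i - 'X^M * ('X * q * p i).
  have -> : p i.+2 = p i.+1 - 'X * (P * (1 - 'X * P)) * p i.
    by rewrite /p !exprS; ring.
  by rewrite Pq; ring.
elim/ltn_ind: r j => -[|[|r]] IHr [|j] lt_jM lt_rj //.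
- by rewrite /p !expr0 coefD !coef1 addr0.
- by rewrite /p !expr1 subrK coef1.
rewrite pSS !coefB coefXM coefXnM lt_jM subr0 /=.
rewrite !IHr ?subr0 //; lia.
Qed.

Lemma catalan_trunc_reciprocal_exp (M r j : nat) :
  let P := fps_trunc M catalan_series in
  (j < M)%N -> (P ^+ r * (1 - 'X * P) ^+ r)`_j = (j == 0)%N%:R.
Proof.
move=> P lt_jM; have [q Pq] := catalan_trunc_reciprocal M; rewrite -/P in Pq.
suff [t ->] : exists t, P ^+ r * (1 - 'X * P) ^+ r = 1 + 'X^M * t.
  by rewrite coefD coefXnM lt_jM addr0 coef1.
rewrite -exprMn Pq; elim: r => [|r [t IHr]].
  by exists 0; rewrite mulr0 addr0.
by exists (q + (1 + 'X^M * q) * t); rewrite exprS IHr; ring.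
Qed.

(** * The Hankel determinants of the powers of the Catalan series *)

(** Multiplication by 'X^s encodes the shift of index together with the zero
    entries at negative indices; the largest index in the matrix is
    2 N - 1 - s, whence the bound on N. *)
Lemma hankel_det_trunc (M r s N : nat) :
  (N + N <= M + s)%N ->
  hankel_det r (1 - s%:Z) N =
  \det (\matrix_(i < N, j < N)
          ('X^s * fps_trunc M catalan_series ^+ r)`_(i + j).+1).
Proof.
move=> le_NM; congr (\det _); apply/matrixP => i j; rewrite !mxE coefXnM.
have lt_iN := ltn_ord i; have lt_jN := ltn_ord j.
case: ltnP => [lt_s|le_s].
  by have -> : i%:Z + j%:Z + (1 - s%:Z) = Negz (s - (i + j).+2) by lia.
have -> : i%:Z + j%:Z + (1 - s%:Z) = Posz ((i + j).+1 - s) by lia.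
by rewrite coef_fps_trunc_exp //; lia.
Qed.

Theorem theorem1 (m k : nat) (hk : (0 < k)%N) :
  (forall N : nat, (1 <= N <= m + k - 1)%N ->
     hankel_det (2 * k) (1 - k%:Z - m%:Z) N = 0) /\
  (forall n : nat,
     hankel_det (2 * k) (1 - k%:Z - m%:Z) (n + m + k) =
     (-1) ^+ 'C(m + k, 2) * hankel_det (2 * k) (1 - k%:Z + m%:Z) n).
Proof.
have shiftE : 1 - k%:Z - m%:Z = 1 - (m + k)%N%:Z by lia.
rewrite shiftE; split=> [[//|N] le_N|n].
  rewrite (@hankel_det_trunc (N.+1 + N.+1)) ?leq_addr //.
  rewrite (expand_det_row _ ord0) big1 // => j _.
  rewrite mxE add0n coefXnM ifT ?mul0r //; have := ltn_ord j; lia.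
(* Both determinants and the relation a * b = 1 used to compare them involve
   only coefficients of index less than M. *)
pose s := (m + k)%N; rewrite -/s; pose M := (s + n + n)%N.
pose P := fps_trunc M catalan_series.
have -> : (n + m + k = s + n)%N by rewrite /s; lia.
rewrite (@hankel_det_trunc M); last by rewrite /M; lia.
have M0 : (0 < M)%N by rewrite /M /s; lia.
have coef0 (p : {poly rat}) r : p`_0 = 1 -> (p ^+ r)`_0 = 1.
  by rewrite -!horner_coef0 horner_exp => ->; rewrite expr1n.
rewrite (@hankel_reciprocal _ _ ((1 - 'X * P) ^+ (2 * k))).
- congr (_ * \det _); apply/matrixP => i j; rewrite !mxE.
  have lt_in := ltn_ord i; have lt_jn := ltn_ord j.
  have lt_M : ((i + j + s).+1 < M)%N by rewrite /M; lia.
  have lt_2k : (2 * k < ((i + j + s).+1).*2)%N by rewrite /s; lia.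
  have /eqP := catalan_power_sum_coef lt_M lt_2k.
  rewrite -/P coefD addr_eq0 => /eqP ->.
  rewrite opprK exprMn coefXnM; case: ltnP => [lt_k|le_k].
    have -> : i%:Z + j%:Z + (1 - k%:Z + m%:Z) = Negz (2 * k - (i + j + s).+2).
      by rewrite /s in lt_k *; lia.
    by [].
  have -> : i%:Z + j%:Z + (1 - k%:Z + m%:Z) = Posz ((i + j + s).+1 - 2 * k).
    by rewrite /s in le_k *; lia.
  by rewrite coef_fps_trunc_exp //= /M; lia.
- by apply: coef0; rewrite coef_poly M0 /catalan_series bin0 divr1.
- by apply: coef0; rewrite coefB coef1 coefXM subr0.
- by move=> j lt_jM; apply: catalan_trunc_reciprocal_exp.
Qed.
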